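(* Let $(X,d)$ be a metric space, let $f:X\to X$ be a map such that $(X,d)$ is $f$-orbitally complete, and let $x_0\in X$. Let $\varphi_{x_0}:(0,\infty)\to(0,\infty)$ be a function such that $\varphi_{x_0}(t)<t$ and $\limsup_{s\to t^+}\varphi_{x_0}(s)<t$ for all $t>0$. Suppose that for all $x,y\in\overline{O(x_0,f)}$ with $x\neq y$, $$d(f(x),f(y))\le \varphi_{x_0}\big(\max\{d(x,y),\ d(x,f(x)),\ d(y,f(y))\}\big).$$ Let $z=\lim_{n\to\infty}f^n(x_0)\in X$. Then $z$ is a fixed point of $f$, i.e. $f(z)=z$ (without assuming that $f$ is orbitally continuous at $z$).
   Context: For a map $f:X\to X$ and $x\in X$, the orbit is $O(x,f)=\{x,f(x),f^2(x),f^3(x),\ldots\}$, where $f^n$ is the $n$-th iterate of $f$, and $\overline{O(x,f)}$ denotes its closure in $X$. The metric space $(X,d)$ is called $f$-orbitally complete if every Cauchy sequence contained in $O(x,f)$, for some $x\in X$, converges in $X$. The map $f$ is orbitally continuous at a point $z$ if, for every $x\in X$ and every sequence of positive integers $(m_i)$, $f^{m_i}(x)\to z$ implies $f(f^{m_i}(x))\to f(z)$. It is a known earlier result (R. K. Bisht) that under the stated hypotheses the sequence $(f^n(x_0))$ is Cauchy and converges in $X$, so that $z$ is well defined. *)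

(* Defs.v *)
From HB Require Import structures.
From mathcomp Require Import all_boot all_order all_algebra.
From mathcomp Require Import all_classical all_reals all_analysis.

Set Implicit Arguments.
Unset Strict Implicit.
Unset Printing Implicit Defensive.

Import Order.TTheory GRing.Theory Num.Theory.
Import numFieldNormedType.Exports.

Local Open Scope classical_set_scope.
Local Open Scope ring_scope.

Definition forward_orbit (X : Type) (f : X -> X) (x : X) : set X :=
  range (fun n : nat => iter n f x).

(* The Cauchy sequences [u] are arbitrary sequences of points of the orbit, not
   only subsequences of the iterates. The limit is stated with an existential
   because the library's [cvg] would require [X] to be a pointed type. *)
Definition orbitally_complete (R : realType) (X : metricType R) (f : X -> X)
  : Prop :=
  forall (x : X) (u : nat -> X),
    (forall n, forward_orbit f x (u n)) ->
    cauchy (u @ \oo) ->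
    exists l : X, u @ \oo --> l.

(* Main.v *)
Require Import Defs.
From HB Require Import structures.
From mathcomp Require Import all_boot all_order all_algebra.
From mathcomp Require Import all_classical all_reals all_analysis.

Set Implicit Arguments.
Unset Strict Implicit.
Unset Printing Implicit Defensive.

Import Order.TTheory GRing.Theory Num.Theory.
Import numFieldNormedType.Exports.

Local Open Scope classical_set_scope.
Local Open Scope ring_scope.

(** Write [x_n] for the [n]-th iterate of [x0].

    The upper limit condition together with [phi t < t] gives a Meir-Keeler
    gap: for every [t > 0] there is [delta > 0] such that [phi s < t] whenever
    [t <= s < t + delta] ([meir_keeler_limsup]). Since the steps
    [mdist x_n x_(n+1)] are nonincreasing, the gap at their infimum forces them
    to tend to [0] ([step_small]). Once the steps from [x_n]
    on are smaller than [e] and than the gap [delta] at [e], induction on [k]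
    keeps [mdist x_n x_(n+k)] below
    [e + delta], so the orbit is Cauchy ([orbit_cauchy]).

    Let [z] be the limit and suppose [r = mdist z (f z) > 0]. For [n] large,
    [x_n] differs from [z], since otherwise [x_(n+1) = f z] would be at distance
    [r] from [z]. Moreover [mdist x_n z] and [mdist x_n x_(n+1)] are at most [r],
    so the maximum in the contraction condition for the pair [(x_n, z)] is
    exactly [r], and [mdist x_(n+1) (f z) <= phi r]. As [phi r < r], this keeps
    [x_(n+1)] at distance at least [r - phi r > 0] from [z], contrary to the
    convergence: continuity of [f] at [z] plays no role ([limit_fixed]). *)

(** The Meir-Keeler gap of a comparison function. *)
Definition meir_keeler (R : realType) (phi : R -> R) : Prop :=
  forall t : R, 0 < t ->
    exists2 delta : R, 0 < delta &
      forall s : R, t <= s < t + delta -> phi s < t.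

(** The contraction condition, for distinct points of [A]. *)
Definition max_contraction (R : realType) (X : metricType R) (phi : R -> R)
    (f : X -> X) (A : set X) : Prop :=
  forall x y : X, A x -> A y -> x <> y ->
    mdist (f x) (f y) <=
      phi (Num.max (mdist x y) (Num.max (mdist x (f x)) (mdist y (f y)))).

Lemma meir_keeler_limsup (R : realType) (phi : R -> R) :
  (forall t : R, 0 < t -> phi t < t) ->
  (forall t : R, 0 < t ->
    (limf_esup (fun s : R => (phi s)%:E) (at_right t) < t%:E)%E) ->
  meir_keeler phi.
Proof.
move=> phi_lt phi_limsup t t0.
have /ereal_inf_lt[_ [V Vt <-] supV] := phi_limsup t t0.
case: Vt => /= delta delta0 Vdelta.
exists delta => // s /andP[ts sd].
move: ts; rewrite le_eqVlt => /predU1P[<-|ts]; first exact: phi_lt.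
rewrite -lte_fin; apply: le_lt_trans supV.
apply: ereal_sup_ubound; exists s => //.
apply: Vdelta => //=.
by rewrite distrC ger0_norm ?subr_ge0 1?ltW// ltrBlDl.
Qed.

Lemma orbit_in_closure (R : realType) (X : metricType R) (f : X -> X) (x0 : X)
    (n : nat) : closure (forward_orbit f x0) (iter n f x0).
Proof. by apply: subset_closure; exists n. Qed.
Arguments orbit_in_closure {R X} f x0 n _ _.

Lemma limit_in_closure (R : realType) (X : metricType R) (f : X -> X)
    (x0 z : X) :
  iter n f x0 @[n --> \oo] --> z -> closure (forward_orbit f x0) z.
Proof.
move=> xz B /xz[N _ NB].
by exists (iter N f x0); split; [exists N | apply: (NB N) => /=].
Qed.

Section Orbit.
Context (R : realType) (X : metricType R) (f : X -> X) (x0 : X) (phi : R -> R).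
Hypothesis phi_lt : forall t : R, 0 < t -> phi t < t.
Hypothesis f_contr : max_contraction phi f (closure (forward_orbit f x0)).

Local Notation x_ n := (iter n f x0).
Local Notation step n := (mdist (x_ n) (x_ n.+1)).

Lemma step_contr (n : nat) : 0 < step n -> step n.+1 <= phi (step n).
Proof.
move=> an0; have xn : x_ n <> x_ n.+1 by apply/eqP; rewrite -mdist_gt0.
have := f_contr (orbit_in_closure f x0 n) (orbit_in_closure f x0 n.+1) xn.
rewrite -/(iter n.+1 f x0) -/(iter n.+2 f x0) maxA maxxx.
have [//|lt_step] := leP (step n.+1) (step n).
(* If the later step were the larger one, it would be less than itself. *)
by move/le_lt_trans => /(_ _ (phi_lt (lt_trans an0 lt_step))); rewrite ltxx.
Qed.

Lemma step_decr (n : nat) : step n.+1 <= step n.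
Proof.
have [an_le0|an0] := leP (step n) 0; last first.
  exact: le_trans (step_contr an0) (ltW (phi_lt an0)).
have /mdist_positivity xn : step n = 0.
  by apply/eqP; rewrite eq_le an_le0 mdist_ge0.
have -> : x_ n.+2 = x_ n.+1 by rewrite [LHS]iterS -xn.
by rewrite mdistxx mdist_ge0.
Qed.

Lemma step_nonincreasing (m n : nat) : (m <= n)%N -> step n <= step m.
Proof.
move=> /subnK <-; elim: (n - m)%N => // k IH.
by apply: le_trans IH; rewrite addSn; exact: step_decr.
Qed.

Hypothesis phi_mk : meir_keeler phi.

Lemma step_small (e : R) :
  0 < e -> exists N : nat, forall n, (N <= n)%N -> step n < e.
Proof.
move=> e0; apply: contrapT => no_small.
have step_ge n : e <= step n.
  rewrite leNgt; apply/negP => an_lt; apply: no_small; exists n => m nm.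
  exact: le_lt_trans (step_nonincreasing nm) an_lt.
pose S : set R := range (fun n => step n).
have lbS : lbound S e by move=> _ [n _ <-].
have infS : has_inf S by split; [exists (step 0), 0%N | exists e].
have a0 : 0 < inf S.
  by apply: lt_le_trans e0 _; apply: lb_le_inf => //; case: infS.
have inf_step n : inf S <= step n by apply: ge_inf; [case: infS | exists n].
have [delta delta0 gap] := phi_mk a0.
have [_ [n _ <-] an_lt] := inf_adherent delta0 infS.
have /step_contr an1 : 0 < step n by exact: lt_le_trans (inf_step n).
have phi_lt_inf : phi (step n) < inf S by apply: gap; rewrite inf_step an_lt.
have := lt_le_trans (le_lt_trans an1 phi_lt_inf) (inf_step n.+1).
by rewrite ltxx.
Qed.

(** The inductive heart of the Cauchy property: once the steps are below [e]
    and below the gap [delta] at [e] from index [n] on, the orbit stays in the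
    open ball of radius [e + delta] around its [n]-th point. *)
Lemma orbit_trapped (e delta : R) (n : nat) : 0 < e -> 0 < delta ->
  (forall s : R, e <= s < e + delta -> phi s < e) ->
  (forall m, (n <= m)%N -> step m < e /\ step m < delta) ->
  forall k, mdist (x_ n) (x_ (n + k)%N) < e + delta.
Proof.
move=> e0 delta0 gap small; elim=> [|k IH].
  by rewrite addn0 mdistxx addr_gt0.
rewrite addnS.
have [an_e an_delta] := small n (leqnn n).
have [ank_e _] := small (n + k)%N (leq_addr k n).
apply: le_lt_trans (metric_triangle _ (x_ n.+1) _) _.
rewrite addrC; apply: ltrD => //.
have [xeq|xneq] := pselect (x_ n = x_ (n + k)%N).
  by rewrite !iterS -xeq mdistxx.
have := f_contr (orbit_in_closure f x0 n) (orbit_in_closure f x0 (n + k)) xneq.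
rewrite -/(iter n.+1 f x0) -/(iter (n + k).+1 f x0).
set M := Num.max _ _ => /le_lt_trans; apply.
have M0 : 0 < M by rewrite lt_max mdist_gt0; apply/orP; left; exact/eqP.
have [eM|Me] := leP e M; last exact: lt_trans (phi_lt M0) Me.
have ltD s : s < e -> s < e + delta by move=> /lt_trans; apply; rewrite ltrDl.
by apply: gap; rewrite eM !gt_max IH !ltD.
Qed.

Lemma orbit_cauchy : cauchy (iter n f x0 @[n --> \oo]).
Proof.
apply/cauchy_ballP => e e0.
(* Each point of the tail must lie within [e / 2] of [x_N], so both the level
   and the gap are taken at most [e / 2 / 2]. *)
have e20 : 0 < e / 2 / 2 by rewrite !divr_gt0.
have [d d0 gap] := phi_mk e20.
pose delta := Num.min d (e / 2 / 2).
have delta0 : 0 < delta by rewrite lt_min d0.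
have [N step_N] := step_small delta0.
have trapped k : mdist (x_ N) (x_ (N + k)%N) < e / 2.
  have /lt_le_trans : mdist (x_ N) (x_ (N + k)%N) < e / 2 / 2 + delta.
    apply: orbit_trapped => // [s /andP[es sd]|m /step_N am].
      by apply: gap; rewrite es (lt_le_trans sd)// lerD2l ge_min lexx.
    by split=> //; apply: lt_le_trans am _; rewrite ge_min lexx orbT.
  by apply; rewrite [leRHS]splitr lerD2l ge_min lexx orbT.
have near_xN : \forall n \near \oo, ball (x_ N) (e / 2) (x_ n).
  by exists N => // n /= /subnKC <-; rewrite ballEmdist; exact: trapped.
exists (ball (x_ N) (e / 2), ball (x_ N) (e / 2)) => //=.
by move=> [x y] [/= xNx xNy]; exact: ball_splitr xNx xNy.
Qed.

End Orbit.

Lemma limit_fixed (R : realType) (X : metricType R) (f : X -> X) (x0 z : X)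
    (phi : R -> R) :
  (forall t : R, 0 < t -> phi t < t) ->
  max_contraction phi f (closure (forward_orbit f x0)) ->
  iter n f x0 @[n --> \oo] --> z -> f z = z.
Proof.
move=> phi_lt f_contr xz; apply: contrapT => fz_neq.
pose r := mdist z (f z).
have r0 : 0 < r by rewrite mdist_gt0; apply/eqP => /esym.
have phir : 0 < r - phi r by rewrite subr_gt0 phi_lt.
(* [r / 2] makes the maximum in the contraction equal to [r]; [r - phi r] then
   contradicts the triangle inequality. *)
pose e := Num.min (r / 2) (r - phi r).
have e0 : 0 < e by rewrite lt_min divr_gt0.
have [N _ near_z] := metricType_numDomainType.cvgr_dist_lt xz e0.
have zN n : (N <= n)%N -> mdist z (iter n f x0) < e by exact: near_z.
have zN2 n : (N <= n)%N -> mdist z (iter n f x0) < r / 2.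
  by move=> /zN /lt_le_trans; apply; rewrite ge_min lexx.
have r2r : r / 2 <= r by rewrite [leRHS]splitr lerDl ltW// divr_gt0.
have xN_neq : iter N f x0 <> z.
  move=> xNz; have := zN2 _ (leqnSn N).
  by rewrite iterS xNz -/r ltNge r2r.
have := f_contr _ _ (orbit_in_closure f x0 N) (limit_in_closure xz) xN_neq.
have -> : Num.max (mdist (iter N f x0) z)
    (Num.max (mdist (iter N f x0) (f (iter N f x0))) (mdist z (f z))) = r.
  have dxz : mdist (iter N f x0) z <= r.
    by rewrite metric_sym (le_trans (ltW (zN2 _ _))).
  have dstep : mdist (iter N f x0) (f (iter N f x0)) <= r.
    apply: le_trans (metric_triangle _ z _) _.
    by rewrite (splitr r) lerD ?ltW// ?(zN2 N.+1)// metric_sym zN2.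
  by rewrite -/r (max_idPr dstep) (max_idPr dxz).
apply/negP; rewrite -ltNge -(ltrD2l (mdist z (iter N.+1 f x0))).
apply: lt_le_trans (metric_triangle z (iter N.+1 f x0) (f z)).
rewrite -ltrBrDr.
by apply: lt_le_trans (zN _ (leqnSn N)) _; rewrite ge_min lexx orbT.
Qed.

Theorem mainTheorem2 (R : realType) (X : metricType R) (f : X -> X) (x0 : X)
    (phi : R -> R)
    (f_complete : orbitally_complete f)
    (phi_gt0 : forall t : R, 0 < t -> 0 < phi t)
    (phi_lt : forall t : R, 0 < t -> phi t < t)
    (phi_limsup : forall t : R, 0 < t ->
      (limf_esup (fun s : R => (phi s)%:E) (at_right t) < t%:E)%E)
    (f_contr : forall x y : X,
      closure (forward_orbit f x0) x -> closure (forward_orbit f x0) y ->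
      x <> y ->
      mdist (f x) (f y) <=
        phi (Num.max (mdist x y) (Num.max (mdist x (f x)) (mdist y (f y))))) :
  (exists z : X, iter n f x0 @[n --> \oo] --> z) /\
  (forall z : X, iter n f x0 @[n --> \oo] --> z -> f z = z).
Proof.
split=> [|z]; last exact: limit_fixed phi_lt f_contr.
apply: (f_complete x0) => [n|]; first by exists n.
exact: (orbit_cauchy phi_lt f_contr (meir_keeler_limsup phi_lt phi_limsup)).
Qed.
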